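(* Let $0\le p\le1$ and let $\Lambda$ be the phase flip channel on a single qubit, with Kraus operators $K_0=\sqrt{p}\,\mathbb{I}$, $K_1=\sqrt{1-p}\,|0\rangle\langle0|$, $K_2=\sqrt{1-p}\,|1\rangle\langle1|$. If $M_{l_1}$ is chosen as the measure of imaginarity, then the quantum state order does not change after a single qubit goes through the phase flip channel; that is, for arbitrary qubit states $\rho_1,\rho_2$, $$M_{l_1}(\rho_1)\le M_{l_1}(\rho_2)\iff M_{l_1}(\Lambda(\rho_1))\le M_{l_1}(\Lambda(\rho_2)).$$
   Context: Fix the basis $\{|0\rangle,|1\rangle\}$ of the qubit space $\mathbb{C}^2$. The channel acts by $\Lambda(\rho)=\sum_{j=0}^2K_j\rho K_j^\dagger$. $\mathcal{F}$ is the set of density matrices with all real entries in this basis, and $M_{l_1}(\rho)=\min_{\sigma\in\mathcal{F}}\|\rho-\sigma\|_{l_1}=\sum_{i\ne j}|\mathrm{Im}(\rho_{ij})|$, where $\|A\|_{l_1}=\sum_{ij}|A_{ij}|$. A channel $\Lambda$ does not change the quantum state order for a measure $M$ if $M(\rho_1)\le M(\rho_2)\Leftrightarrow M(\Lambda(\rho_1))\le M(\Lambda(\rho_2))$ for arbitrary two states $\rho_1,\rho_2$.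
   Formalization: The case p = 0 is excluded (0 < p ≤ 1 is assumed): at p = 0 every output state is diagonal with measure 0, so the equivalence fails, e.g. for ρ1 the projector on (|0⟩+i|1⟩)/√2 and ρ2 = |0⟩⟨0|. *)

(* Defs.v *)
From mathcomp Require Export all_boot all_order all_algebra.
From mathcomp Require Export complex.
From mathcomp Require Export boolp classical_sets reals.

Set Implicit Arguments.
Unset Strict Implicit.
Unset Printing Implicit Defensive.

Import Order.TTheory GRing.Theory Num.Theory.
Local Open Scope classical_set_scope.
Local Open Scope ring_scope.
Local Open Scope complex_scope.
Local Open Scope sesquilinear_scope.

(* Matrices are written in the fixed reference basis |0>, ..., |n-1>, which is
   the standard basis of C^n. *)

Definition psdmx (R : realType) n (A : 'M[R[i]]_n) : Prop :=
  A \is hermsymmx /\ forall v : 'cV[R[i]]_n, 0 <= (v ^t* *m A *m v) 0 0.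

Definition density (R : realType) n : set 'M[R[i]]_n :=
  [set rho | psdmx rho /\ \tr rho = 1].

Definition real_density (R : realType) n : set 'M[R[i]]_n :=
  [set rho | density rho /\ forall i j, complex.Im (rho i j) = 0].

Definition l1norm (R : realType) m n (A : 'M[R[i]]_(m, n)) : R :=
  \sum_i \sum_j ComplexField.Normc.normc (A i j).

(* For a density matrix rho the minimum over the real states is attained, at
   the entrywise real part of rho, so the infimum below is that minimum. *)
Definition imaginarity_l1 (R : realType) n (rho : 'M[R[i]]_n) : R :=
  inf [set l1norm (rho - sigma) | sigma in @real_density R n].

Definition kraus_map (R : realType) k n (K : 'I_k -> 'M[R[i]]_n)
    (rho : 'M[R[i]]_n) : 'M[R[i]]_n :=
  \sum_j K j *m rho *m (K j) ^t*.

Definition ket (R : realType) n (i : 'I_n) : 'cV[R[i]]_n := delta_mx i 0.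

Definition phase_flip_kraus (R : realType) (p : R) (j : 'I_3) : 'M[R[i]]_2 :=
  tnth [tuple (Num.sqrt p)%:C *: 1%:M;
              (Num.sqrt (1 - p))%:C *: (ket R 0 *m (ket R 0) ^t*);
              (Num.sqrt (1 - p))%:C *: (ket R 1 *m (ket R 1) ^t*)] j.

(* Off-diagonal entries are multiplied by p: at p = 0 the output is diagonal,
   every imaginarity_l1 becomes 0, and the order is preserved but not reflected. *)
Definition phase_flip (R : realType) (p : R) : 'M[R[i]]_2 -> 'M[R[i]]_2 :=
  kraus_map (phase_flip_kraus p).

Definition preserves_state_order (R : realType) n
    (M : 'M[R[i]]_n -> R) (L : 'M[R[i]]_n -> 'M[R[i]]_n) : Prop :=
  forall rho1 rho2, density rho1 -> density rho2 ->
    M rho1 <= M rho2 <-> M (L rho1) <= M (L rho2).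

(* Main.v *)
(* The entrywise real part of a state is the average of the state and its
   entrywise conjugate, hence again a state; since |Im z| is the distance from z
   to the real axis, it is a nearest real state, which gives
   M(rho) = \sum |Im rho_ij|. The channel fixes the real diagonal and multiplies
   the off-diagonal entries by p, so it multiplies M by p > 0. *)
Require Import Defs.
From mathcomp Require Import ring.
Set Implicit Arguments.
Unset Strict Implicit.
Import Order.TTheory GRing.Theory Num.Theory.
Local Open Scope ring_scope.
Local Open Scope classical_set_scope.
Local Open Scope complex_scope.
Local Open Scope sesquilinear_scope.

Section States.
Variable R : realType.
Implicit Types m n k : nat.

Lemma adjmxM m n k (A : 'M[R[i]]_(m, n)) (B : 'M[R[i]]_(n, k)) :
  (A *m B)^t* = B^t* *m A^t*.
Proof. by rewrite trmx_mul map_mxM. Qed.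

Lemma adjmxK m n (A : 'M[R[i]]_(m, n)) : A^t*^t* = A.
Proof. by apply/matrixP => i j; rewrite !mxE conjCK. Qed.

Lemma hermsymmx_adjP n (A : 'M[R[i]]_n) : reflect (A = A^t*) (A \is hermsymmx).
Proof. by apply: (iffP (is_hermitianmxP _ _ _)); rewrite expr0 scale1r. Qed.

Lemma psdmxD n (A B : 'M[R[i]]_n) : psdmx A -> psdmx B -> psdmx (A + B).
Proof.
move=> [/hermsymmx_adjP Ah Ap] [/hermsymmx_adjP Bh Bp]; split.
  by apply/hermsymmx_adjP; rewrite raddfD map_mxD -Ah -Bh.
by move=> v; rewrite mulmxDr mulmxDl mxE addr_ge0.
Qed.

Lemma psdmx_sum n (I : finType) (A : I -> 'M[R[i]]_n) :
  (forall i, psdmx (A i)) -> psdmx (\sum_i A i).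
Proof.
move=> Apsd; apply: (big_ind (@psdmx R n)); [split | exact: psdmxD | by []].
- by apply/hermsymmx_adjP; rewrite trmx0 map_mx0.
- by move=> v; rewrite mulmx0 mul0mx mxE.
Qed.

Lemma psdmxZ n (c : R[i]) (A : 'M[R[i]]_n) :
  0 <= c -> psdmx A -> psdmx (c *: A).
Proof.
move=> c0 [/hermsymmx_adjP Ah Ap]; split; last first.
  by move=> v; rewrite -scalemxAr -scalemxAl mxE mulr_ge0.
by apply/hermsymmx_adjP; rewrite linearZ map_mxZ -Ah /= geC0_conj.
Qed.

(** The quadratic form of the conjugated matrix at [v] is the conjugate of the form of [A] at the
    conjugate of [v], and conjugation fixes nonnegative numbers. *)
Lemma psdmx_conj n (A : 'M[R[i]]_n) : psdmx A -> psdmx (map_mx Num.conj A).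
Proof.
move=> [/hermsymmx_adjP Ah Ap]; split.
  by apply/hermsymmx_adjP; rewrite map_trmx -Ah.
move=> v; have <- : map_mx Num.conj (map_mx Num.conj v) = v.
  by apply/matrixP => i j; rewrite !mxE conjCK.
by rewrite map_trmx -!map_mxM mxE conjC_ge0 Ap.
Qed.

Lemma psdmx_congr m n (K : 'M[R[i]]_(m, n)) (A : 'M[R[i]]_n) :
  psdmx A -> psdmx (K *m A *m K^t*).
Proof.
move=> [/hermsymmx_adjP Ah Ap]; split.
  by apply/hermsymmx_adjP; rewrite !adjmxM adjmxK -Ah mulmxA.
move=> v; have := Ap (K^t* *m v).
by rewrite adjmxM adjmxK !mulmxA.
Qed.

(** Positivity holds term by term, by congruence. For the trace, cyclicity turns each
    [K j *m rho *m (K j)^t*] into [(K j)^t* *m K j *m rho], and completeness collapses the sum to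
    [\tr rho]. *)
Lemma density_kraus_map k n (K : 'I_k -> 'M[R[i]]_n) (rho : 'M[R[i]]_n) :
  \sum_j (K j)^t* *m K j = 1%:M -> density rho -> density (kraus_map K rho).
Proof.
move=> K1 [rpsd rtr]; split; first by apply: psdmx_sum => j; exact: psdmx_congr.
rewrite /kraus_map raddf_sum -rtr -[in RHS](mul1mx rho) -K1 mulmx_suml raddf_sum.
by apply: eq_bigr => j _; rewrite /= mxtrace_mulC mulmxA.
Qed.

Definition mxRe n (A : 'M[R[i]]_n) : 'M[R[i]]_n :=
  map_mx (fun z => (complex.Re z)%:C) A.

Lemma mxReE n (A : 'M[R[i]]_n) : mxRe A = 2^-1 *: (A + map_mx Num.conj A).
Proof. by apply/matrixP => i j; rewrite !mxE complexRe ReE mulrC. Qed.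

Lemma real_density_mxRe n (rho : 'M[R[i]]_n) :
  density rho -> real_density (mxRe rho).
Proof.
move=> [rpsd rtr]; split; last by move=> i j; rewrite mxE.
split.
  rewrite mxReE; apply: psdmxZ; first by rewrite invr_ge0 ler0n.
  exact: psdmxD rpsd (psdmx_conj rpsd).
rewrite mxReE linearZ /= raddfD /= trace_map_mx rtr rmorph1.
by rewrite mulVf // pnatr_eq0.
Qed.

Lemma normc_ge_Im (z : R[i]) : `|complex.Im z| <= ComplexField.Normc.normc z.
Proof.
case: z => a b /=; rewrite -sqrtr_sqr ler_wsqrtr // lerDr; exact: sqr_ge0.
Qed.

Lemma normc_subRe (z : R[i]) :
  ComplexField.Normc.normc (z - (complex.Re z)%:C) = `|complex.Im z|.
Proof. by case: z => a b /=; rewrite subrr subr0 expr0n add0r sqrtr_sqr. Qed.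

Lemma imaginarity_l1E n (rho : 'M[R[i]]_n) : density rho ->
  imaginarity_l1 rho = \sum_i \sum_j `|complex.Im (rho i j)|.
Proof.
move=> rd; rewrite /imaginarity_l1; set S := (X in inf X); set s := \sum_i _.
have sS : S s.
  exists (mxRe rho); first exact: real_density_mxRe.
  apply: eq_bigr => i _; apply: eq_bigr => j _.
  by rewrite !mxE normc_subRe.
(* Since [sigma] is real, [rho - sigma] has the same imaginary parts as [rho], and the modulus of
   each entry dominates its imaginary part. *)
have lbs : lbound S s.
  move=> _ [sigma [_ sR] <-]; apply: ler_sum => i _; apply: ler_sum => j _.
  rewrite (le_trans _ (normc_ge_Im _)) // !mxE raddfB /=.
  by rewrite sR subr0.
apply/eqP; rewrite eq_le; apply/andP; split.
  by apply: ge_inf => //; exists s.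
by apply: lb_le_inf => //; exists s.
Qed.

Lemma density_Im_diag n (rho : 'M[R[i]]_n) i :
  density rho -> complex.Im (rho i i) = 0.
Proof.
move=> [[/hermsymmx_adjP rh _] _]; have : rho i i = (rho i i)^*.
  by rewrite {1}rh !mxE.
(* Comparing imaginary parts gives [b = - b], hence [b *+ 2 = 0]. *)
case: (rho i i) => a b [] /= /eqP.
by rewrite -addr_eq0 -mulr2n mulrn_eq0 => /eqP.
Qed.

End States.

Section PhaseFlip.
Variables (R : realType) (p : R).
Hypothesis hp : 0 <= p <= 1.

Lemma ket_projE n (i : 'I_n) : ket R i *m (ket R i)^t* = delta_mx i i.
Proof. by rewrite /ket trmx_delta map_delta_mx mul_delta_mx. Qed.

Lemma adjmxZ_real m n (c : R) (A : 'M[R[i]]_(m, n)) :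
  (c%:C *: A)^t* = c%:C *: A^t*.
Proof. by rewrite linearZ map_mxZ; congr (_ *: _); exact: conjc_real. Qed.

Lemma ord2P (i : 'I_2) : i = 0 \/ i = 1.
Proof. by case: i => [[|[|//]] ?]; [left|right]; exact: val_inj. Qed.

Lemma adjmxMl_sqrt m n (c : R) (K : 'M[R[i]]_(m, n)) : 0 <= c ->
  ((Num.sqrt c)%:C *: K)^t* *m ((Num.sqrt c)%:C *: K) = c%:C *: (K^t* *m K).
Proof.
move=> c0; rewrite adjmxZ_real -scalemxAl -scalemxAr scalerA.
by rewrite -rmorphM -expr2 sqr_sqrtr.
Qed.

Lemma congrmx_sqrt m n (c : R) (K : 'M[R[i]]_(m, n)) (A : 'M[R[i]]_n) :
  0 <= c ->
  ((Num.sqrt c)%:C *: K) *m A *m ((Num.sqrt c)%:C *: K)^t* =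
  c%:C *: (K *m A *m K^t*).
Proof.
move=> c0; rewrite adjmxZ_real -scalemxAl -scalemxAl -scalemxAr scalerA.
by rewrite -rmorphM -expr2 sqr_sqrtr.
Qed.

(** An expression [G] quadratic in the Kraus operator turns the factor [Num.sqrt c] into the weight
    [c]. Stated for general [G] so as to serve both the completeness relation and the action on a
    state. *)
Lemma sum_phase_flip_kraus (G H : 'M[R[i]]_2 -> 'M[R[i]]_2) :
  (forall (c : R) K, 0 <= c -> G ((Num.sqrt c)%:C *: K) = c%:C *: H K) ->
  \sum_j G (phase_flip_kraus p j) =
  p%:C *: H 1%:M + ((1 - p)%:C *: H (delta_mx 0 0)
                    + (1 - p)%:C *: H (delta_mx 1 1)).
Proof.
move=> GE; have /andP[p0] := hp; rewrite -subr_ge0 => p1.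
rewrite !big_ord_recl big_ord0 addr0 /phase_flip_kraus.
rewrite !(tnth_nth 0) /= !ket_projE.
by congr (_ + (_ + _)); exact: GE.
Qed.

(** The two projectors add up to the identity, so the sum is [p + (1 - p)] times the identity. *)
Lemma phase_flip_kraus_complete :
  \sum_j (phase_flip_kraus p j)^t* *m phase_flip_kraus p j = 1%:M.
Proof.
rewrite (sum_phase_flip_kraus (G := fun K => K^t* *m K) (@adjmxMl_sqrt 2 2)).
rewrite !trmx_delta !map_delta_mx !mul_delta_mx trmx1 map_mx1 mulmx1.
apply/matrixP => i j; rewrite !mxE rmorphB rmorph1.
by case: (ord2P i) => ->; case: (ord2P j) => -> /=; ring.
Qed.

(** The channel outputs [p] times [rho] plus [1 - p] times the diagonal part of [rho]. *)
Lemma phase_flipE (rho : 'M[R[i]]_2) i j :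
  phase_flip p rho i j = (if i == j then 1 else p%:C) * rho i j.
Proof.
have deltaE (k : 'I_2) :
    delta_mx k k *m rho *m delta_mx k k = rho k k *: delta_mx k k.
  (* Factoring the projector as a column times a row leaves a 1 by 1 matrix in the middle, namely
     the scalar [rho k k]. *)
  rewrite -(mul_delta_mx (0 : 'I_1) k k).
  transitivity (delta_mx k 0 *m row k (col k rho) *m delta_mx (0 : 'I_1) k).
    by rewrite rowE colE !mulmxA.
  by rewrite [row k _]mx11_scalar mul_mx_scalar -scalemxAl mul_delta_mx !mxE.
rewrite /phase_flip /kraus_map.
rewrite (sum_phase_flip_kraus (G := fun K => K *m rho *m K^t*)
  (fun c K => @congrmx_sqrt 2 2 c K rho)).
rewrite !trmx_delta !map_delta_mx !deltaE trmx1 map_mx1 mulmx1 mul1mx.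
rewrite !mxE rmorphB rmorph1.
by case: (ord2P i) => ->; case: (ord2P j) => -> /=; ring.
Qed.

End PhaseFlip.

Theorem proposition5 (R : realType) (p : R) (hp : 0 <= p <= 1) (hp0 : p != 0) :
  preserves_state_order (@imaginarity_l1 R 2) (phase_flip p).
Proof.
have p_gt0 : 0 < p by case/andP: hp => p0 _; rewrite lt0r hp0.
have ME rho : density rho ->
    imaginarity_l1 (phase_flip p rho) = p * imaginarity_l1 rho.
  move=> rd; rewrite !imaginarity_l1E //; last first.
    by apply: density_kraus_map => //; exact: phase_flip_kraus_complete.
  rewrite mulr_sumr; apply: eq_bigr => i _; rewrite mulr_sumr.
  apply: eq_bigr => j _; rewrite phase_flipE //.
  (* A diagonal entry is kept instead of being scaled by [p], but its imaginary part vanishes, so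
     the factor [p] is correct there too. *)
  have [->|_] := eqVneq i j.
    by rewrite mul1r density_Im_diag // normr0 mulr0.
  by case: (rho i j) => a b /=; rewrite mul0r addr0 normrM gtr0_norm.
(* Multiplication by [p] both preserves and reflects the order because [p] is strictly positive. *)
by move=> rho1 rho2 r1 r2; rewrite !ME // ler_pM2l.
Qed.
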